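(* Let $F$ be a field which either has characteristic $0$, or is algebraically closed of characteristic greater than $5$. Then strong solvability is 2-recognizeable for Leibniz algebras over $F$; that is, if $L$ is a finite-dimensional Leibniz algebra over $F$ such that for all $x,y\in L$ the subalgebra of $L$ generated by $x$ and $y$ is strongly solvable, then $L$ is strongly solvable.
   Context: A (left) Leibniz algebra over a field $F$ is an $F$-vector space $L$ with a bilinear product $(x,y)\mapsto xy$ such that every left multiplication $L_x: y\mapsto xy$ is a derivation, i.e. $x(yz)=(xy)z+y(xz)$ for all $x,y,z\in L$. All algebras are finite-dimensional. For subspaces $U,V$ of $L$, $UV$ denotes the span of all products $uv$ with $u\in U$, $v\in V$. The derived algebra of $L$ is $L^2=LL$. A Leibniz algebra $N$ is nilpotent if the series $N^1=N$, $N^{k+1}=N N^k$ reaches $0$. $L$ is strongly solvable if its derived algebra $L^2$ is nilpotent. A property of algebras is called $n$-recognizeable if, whenever all the $n$-generated subalgebras (subalgebras generated by $n$ elements) of an algebra $L$ have the property, then $L$ also has the property. *)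

(* Defs.v *)
From HB Require Import structures.
From mathcomp Require Import all_boot all_order all_algebra.

Set Implicit Arguments.
Unset Strict Implicit.
Unset Printing Implicit Defensive.

Import GRing.Theory.
Local Open Scope ring_scope.

HB.mixin Record Vector_isLeibniz (F : fieldType) L of Vector F L := {
  lmul : L -> L -> L;
  lmul_bilinear : bilinear_for *:%R *:%R lmul;
  lmul_derivation : forall x y z : L,
    lmul x (lmul y z) = lmul (lmul x y) z + lmul y (lmul x z)
}.

#[short(type="leibnizType")]
HB.structure Definition Leibniz (F : fieldType) :=
  { L of Vector F L & Vector_isLeibniz F L }.

HB.instance Definition _ (F : fieldType) (L : leibnizType F) :=
  bilinear_isBilinear.Build F L L L *:%R *:%R (@lmul F L) lmul_bilinear.

Section Subspaces.

Variables (F : fieldType) (L : leibnizType F).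
Implicit Types (U V W S : {vspace L}).

(* By bilinearity the products of basis vectors already span all products;
   see lprodv_subP. *)
Definition lprodv U V : {vspace L} :=
  <<[seq lmul u v | u <- vbasis U, v <- vbasis V]>>%VS.

Lemma memv_lmul U V u v : u \in U -> v \in V -> lmul u v \in lprodv U V.
Proof.
move=> Uu Vv; rewrite (coord_vbasis Uu) (coord_vbasis Vv).
rewrite linear_sumlz memv_suml // => i _; rewrite linear_sumr memv_suml // => j _.
rewrite linearZl linearZr !memvZ //; apply: memv_span.
by apply: allpairs_f; apply: mem_nth; rewrite size_tuple.
Qed.

Lemma lprodv_subP U V W :
  reflect (forall u v, u \in U -> v \in V -> lmul u v \in W)
          (lprodv U V <= W)%VS.
Proof.
apply: (iffP idP) => [sUVW u v Uu Vv | sUVW].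
  exact: subvP sUVW _ (memv_lmul Uu Vv).
apply/span_subvP => _ /allpairsP[[u v] /= [Uu Vv ->]].
by apply: sUVW; apply: vbasis_mem.
Qed.

Definition is_subalgebra S : bool := (lprodv S S <= S)%VS.

(* The chain A, A + AA, ... stabilises after at most \dim {:L} steps; its limit
   is the least subalgebra containing X, see subalg_genP and subalg_gen_min. *)
Definition subalg_gen (X : seq L) : {vspace L} :=
  iter (\dim {:L}) (fun A : {vspace L} => (A + lprodv A A)%VS) <<X>>%VS.

Lemma sub_subalg_gen (X : seq L) : {subset X <= subalg_gen X}.
Proof.
move=> x Xx; rewrite /subalg_gen; elim: (\dim _) => [|n IHn] /=.
  exact: memv_span.
exact: subvP (addvSl _ _) _ IHn.
Qed.

Lemma subalg_genP (X : seq L) : is_subalgebra (subalg_gen X).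
Proof.
rewrite /subalg_gen; set f := fun A : {vspace L} => _.
have sub_f A : (A <= f A)%VS by apply: addvSl.
have fixP k : f (iter k f <<X>>%VS) = iter k f <<X>>%VS
              \/ (k <= \dim (iter k f <<X>>%VS))%N.
  elim: k => [|k [IHk | IHk]] /=; [by right | by left; rewrite IHk |].
  have [fixA | nfixA] := eqVneq (f (iter k f <<X>>%VS)) (iter k f <<X>>%VS).
    by left; rewrite fixA.
  right; apply: leq_ltn_trans IHk _; rewrite ltn_neqAle dimvS // andbT.
  by apply: contra nfixA => eqd; rewrite eq_sym eqEdim sub_f (eqP eqd) /=.
case: (fixP (\dim {:L})) => [fixA | full].
  by rewrite /is_subalgebra -{3}fixA; apply: addvSr.
rewrite /is_subalgebra; apply: subv_trans (subvf _) _.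
by have /eqP-> : iter (\dim {:L}) f <<X>>%VS == fullv by rewrite eqEdim subvf.
Qed.

Lemma subalg_gen_min (X : seq L) S :
  is_subalgebra S -> {subset X <= S} -> (subalg_gen X <= S)%VS.
Proof.
move=> algS sXS; rewrite /subalg_gen; elim: (\dim _) => [|n IHn] /=.
  exact/span_subvP.
rewrite subv_add IHn /=; apply: subv_trans algS; apply/lprodv_subP => u v Uu Uv.
by apply: memv_lmul; apply: (subvP IHn).
Qed.

(* lower_series N k is N^(k+1). *)
Definition lower_series (N : {vspace L}) (k : nat) : {vspace L} :=
  iter k (lprodv N) N.

Definition nilpotent_subalgebra (N : {vspace L}) : Prop :=
  exists k, lower_series N k = 0%VS.

(* Subalgebras S, fullv included, are treated as subspaces of the ambient
   algebra: the products UV of subspaces of S do not depend on the ambient one. *)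
Definition strongly_solvable S : Prop := nilpotent_subalgebra (lprodv S S).

End Subspaces.

(* P L S reads: the algebra S, a subalgebra of L, has the property. *)
Definition recognizeable (F : fieldType) (n : nat)
    (P : forall L : leibnizType F, {vspace L} -> Prop) : Prop :=
  forall L : leibnizType F,
    (forall X : n.-tuple L, P L (subalg_gen X)) -> P L fullv.

(* Main.v *)
Require Import Defs.
From HB Require Import structures.
From mathcomp Require Import all_boot all_order all_algebra.
From Stdlib Require Import Classical.

(** Write [L_a] for the left multiplication by [a]. Left multiplications satisfy
[L_(ab) = [L_a, L_b]], so the operators [L_(xy)] form a set closed under
commutators. By Jacobson's theorem on weakly closed sets of nilpotent operators
([weakly_closed_flag]), if every [L_(xy)] is nilpotent on the algebra, then
there is a finite flag of subspaces that all of them shift down by one step,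
and the derived algebra is nilpotent ([lprodv_nilpotent]). It remains to show
that [H = L_h], with [h = xy], is nilpotent ([leftmul_nilpotent]).

Since [h] lies in the derived algebra of the subalgebra generated by [x] and
[y], some power [H^n], where [n] depends only on the dimension, kills [x] and
[y] ([engel_of_strongly_solvable]). Let [W] be the Fitting-one component of
[H]: [H] is bijective on [W], and left and right multiplications by [x] and by
[y] preserve [W].

The Engel identity [L_(xy')^n y' = 0] holds for all [y'], in particular for
[y' = y + a v] with [v] in [W] and [a] a scalar. As the field is infinite
([infinite_field]), the coefficient of [a] vanishes. If [w] in [W] solves [hw = xv], then to first order
the perturbation [h + a (xv)] of [h] is the one induced by the derivation [L_w],
which makes this coefficient computable: it is [H^n (v + wy)]
([perturbed_iter]). Hence [v + wy = 0].

This relation first shows that [W] contains no nonzero [z] with [L_z = 0]. Since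
[L_(wy) = - L_(yw)], it then becomes [v = yw] whenever [hw = xv]. Thus left
multiplications by [x] and [y] are bijective on [W], and [x(yv) = hv] on [W].
But also [hv = x(yv) - y(xv)], so [y(xv) = 0] on [W], whence [W = 0] and [H] is
nilpotent. *)

Set Implicit Arguments.
Unset Strict Implicit.
Unset Printing Implicit Defensive.

Import GRing.Theory.
Local Open Scope ring_scope.

(** * Infinite fields and perturbation of iterates *)

Lemma infinite_field (F : fieldType) :
  ([pchar F]%R =i pred0 \/ GRing.closed_field_axiom F) ->
  forall n, exists2 s : seq F, uniq s & size s = n.
Proof.
case=> [charF0 n | closedF].
  exists [seq i%:R : F | i <- iota 0 n]; last by rewrite size_map size_iota.
  rewrite map_inj_uniq ?iota_uniq // => i j.
  wlog le_ij: i j / (i <= j)%N => [IH eq_ij |].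
    by case/orP: (leq_total i j) => le; [| apply/esym]; apply: IH.
  move/eqP; rewrite eq_sym -subr_eq0 -natrB // ((pcharf0P F).1 charF0).
  by rewrite subn_eq0 => le_ji; apply/eqP; rewrite eqn_leq le_ij.
elim=> [|n [s Us sz_s]]; first by exists [::].
(* A root of [\prod_(a <- s) ('X - a%:P) + 1] lies outside [s]. *)
suff [x s'x]: exists x, x \notin s by exists (x :: s); rewrite /= ?s'x ?sz_s.
have [n0 | n_gt0] := posnP n.
  by exists 0; move: sz_s; rewrite n0 => /size0nil->.
pose p := \prod_(a <- s) ('X - a%:P) + 1 : {poly F}.
have sz_p : size p = n.+1.
  by rewrite size_polyDl ?size_prod_XsubC ?sz_s // size_poly1.
have [x] := closedF n (fun i => - p`_i) n_gt0.
have lead_p : p`_n = 1.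
  rewrite coefD coef1 (gtn_eqF n_gt0) addr0.
  have := monic_prod_XsubC s predT id; rewrite monicE lead_coefE.
  by rewrite size_prod_XsubC sz_s => /eqP.
move=> def_x; exists x; apply/negP => s_x.
have: p.[x] = 0.
  rewrite horner_coef sz_p big_ord_recr /= lead_p mul1r def_x -big_split /=.
  by apply: big1 => i _; rewrite mulNr subrr.
rewrite hornerD hornerC horner_prod (big_rem x) //= hornerXsubC subrr mul0r add0r.
by move/eqP; rewrite oner_eq0.
Qed.

Lemma vector_poly_eq0 (F : fieldType) (V : vectType F) (m : nat) (c : nat -> V) :
  (forall n, exists2 s : seq F, uniq s & size s = n) ->
  (forall a : F, \sum_(i < m) a ^+ i *: c i = 0) ->
  forall i, (i < m)%N -> c i = 0.
Proof.
move=> infF c0 i lt_im.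
apply/eqP; rewrite (coord_vbasis (memvf (c i))); apply/eqP/big1 => j _.
pose p := \poly_(l < m) coord (vbasis fullv) j (c l).
have p0 : p = 0.
  have [s Us sz_s] := infF m.
  apply: (@roots_geq_poly_eq0 _ p s) => //; last by rewrite sz_s size_poly.
  apply/allP => a _; rewrite /root horner_poly; apply/eqP.
  transitivity (coord (vbasis fullv) j (\sum_(i < m) a ^+ i *: c i)); last first.
    by rewrite c0 linear0.
  by rewrite linear_sum; apply: eq_bigr => l _; rewrite linearZ /= mulrC.
have := coef_poly m (fun l => coord (vbasis fullv) j (c l)) i.
by rewrite -/p p0 coef0 lt_im => <-; rewrite scale0r.
Qed.

(** The iterates of [A + a B] on [y + a v] are polynomial in [a]. When [B] is the
commutator [[A, C]], the operator [A + a B] is, up to terms in [a ^ 2], the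
conjugate of [A] by [1 - a C], which explains the coefficient [c 1] of [a]. *)
Lemma perturbed_iter (F : fieldType) (V : vectType F) (A B C : 'End(V)) (y v : V) n :
  (forall z, B z = A (C z) - C (A z)) ->
  exists c : nat -> V,
    [/\ c 1%N = iter n A (v + C y) - C (iter n A y),
        forall a, iter n (fun z => A z + a *: B z) (y + a *: v)
                  = \sum_(i < n.+2) a ^+ i *: c i
      & c 0%N = iter n A y /\ forall i, (n.+1 < i)%N -> c i = 0].
Proof.
move=> defB; elim: n => [|n [c [c1 cE [c0 c_gt]]]].
  exists (fun i => if i is i'.+1 then if i' is _.+1 then 0 else v else y).
  split=> [|a|]; [by rewrite /= addrK | | by split=> // -[|[]]].
  by rewrite !big_ord_recl big_ord0 /= expr0 scale1r addr0.
exists (fun i => A (c i) + (if i is i'.+1 then B (c i') else 0)).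
split=> [|a|].
- rewrite c1 c0 defB /= linearB /=.
  by rewrite addrA subrK.
- rewrite iterS cE.
  rewrite (eq_bigr (fun i : 'I_n.+3 => a ^+ i *: A (c i) +
     a ^+ i *: (if i : nat is i'.+1 then B (c i') else 0))); last first.
    by move=> i _; rewrite scalerDr.
  rewrite big_split /=; congr (_ + _).
    rewrite [RHS]big_ord_recr /= c_gt // linear0 scaler0 addr0 linear_sum.
    by apply: eq_bigr => i _; rewrite linearZ.
  rewrite [RHS]big_ord_recl /= scaler0 add0r linear_sum scaler_sumr.
  by apply: eq_bigr => i _; rewrite linearZ /= scalerA -exprS.
- split=> [|i]; first by rewrite c0 addr0.
  by case: i => // i lt_ni; rewrite !c_gt ?linear0 ?addr0 //; apply: ltnW.
Qed.

(** * Fitting decomposition *)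

(** The subspace [W] is the Fitting-one component of [f]. *)
Lemma fitting_one (F : fieldType) (V : vectType F) (f : 'End(V)) :
  exists j (W : {vspace V}), (f @: W)%VS = W /\ forall z, iter j f z \in W.
Proof.
suff: forall d (U : {vspace V}), (\dim U <= d)%N -> (f @: U <= U)%VS ->
    exists j (W : {vspace V}), (f @: W)%VS = W /\
      forall z, z \in U -> iter j f z \in W.
  case/(_ _ fullv (leqnn _) (subvf _)) => j [W [fW Wj]].
  by exists j, W; split=> // z; apply/Wj/memvf.
elim=> [|d IHd] U dimU sfU.
  exists 0%N, U; split=> //; apply/eqP; rewrite eqEsubv sfU.
  by move: dimU; rewrite leqn0 dimv_eq0 => /eqP->; rewrite sub0v.
have [fU | nfU] := eqVneq (f @: U)%VS U; first by exists 0%N, U.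
have [||j [W [fW Wj]]] := IHd (f @: U)%VS; last 1 first.
- exists j.+1, W; split=> // z Uz; rewrite iterSr; apply: Wj.
  exact: memv_img.
- rewrite -ltnS; apply: leq_trans dimU; rewrite ltn_neqAle dimvS // andbT.
  by apply: contra nfU => eqd; rewrite eqEdim sfU (eqP eqd) /=.
- exact: limgS.
Qed.

Lemma img_eq_inj (F : fieldType) (V : vectType F) (f : 'End(V)) (W : {vspace V}) :
  (f @: W)%VS = W -> forall z, z \in W -> f z = 0 -> z = 0.
Proof.
move=> fW z Wz fz0; have := limg_ker_dim f W; rewrite fW => /eqP.
rewrite -[X in _ == X]add0n eqn_add2r dimv_eq0 => /eqP K0.
by apply/eqP; rewrite -memv0 -K0 memv_cap Wz memv_ker fz0 /=.
Qed.

Lemma inj_img_eq (F : fieldType) (V : vectType F) (f : 'End(V)) (W : {vspace V}) :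
  (f @: W <= W)%VS -> (forall z, z \in W -> f z = 0 -> z = 0) -> (f @: W)%VS = W.
Proof.
move=> sfW injf; apply/eqP; rewrite eqEdim sfW -(limg_ker_dim f W).
suff -> : (W :&: lker f)%VS = 0%VS by rewrite dimv0 add0n leqnn.
apply/eqP; rewrite -subv0; apply/subvP => z; rewrite memv_cap memv_ker memv0.
by case/andP=> Wz /eqP/(injf _ Wz)/eqP.
Qed.

(** The Fitting-one component of [f] is stable under every map that commutes with
[f] modulo it. Linearity of [g] is not needed. *)
Lemma fitting_one_stable (F : fieldType) (V : vectType F) (f : 'End(V))
    (W : {vspace V}) j (g : V -> V) :
  (f @: W)%VS = W -> (forall z, iter j f z \in W) ->
  (forall w, w \in W -> f (g w) - g (f w) \in W) ->
  forall w, w \in W -> g w \in W.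
Proof.
move=> fW Wj Wfg w Ww.
have Wf z : z \in W -> f z \in W by rewrite -{2}fW; apply: memv_img.
have [w' Ww' ->] : exists2 w', w' \in W & w = iter j f w'.
  elim: {Wj} j => [|j [w' Ww' ->]]; first by exists w.
  move: Ww'; rewrite -{1}fW => /memv_imgP[w2 Ww2 ->].
  by exists w2; rewrite // iterSr.
suff: iter j f (g w') - g (iter j f w') \in W.
  by rewrite rpredBl.
elim: {Wj} j => [|j IHj]; first by rewrite /= subrr mem0v.
have Wi : iter j f w' \in W by elim: (j) => //= i; apply: Wf.
rewrite !iterS -(subrKA (f (g (iter j f w')))) -linearB memvD ?Wfg //.
exact: Wf.
Qed.

(** * Weakly closed sets of nilpotent operators *)

Lemma span_ind (F : fieldType) (V : vectType F) (X : seq V) (P : V -> Prop) :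
  P 0 -> (forall a x y, x \in X -> P y -> P (a *: x + y)) ->
  forall v, v \in <<X>>%VS -> P v.
Proof.
move=> P0 PD; elim: X PD => [|x X IHX] PD v.
  by rewrite span_nil memv0 => /eqP->.
rewrite span_cons => /memv_addP[_ /vlineP[a ->] [w Xw ->]].
apply: (PD); first exact: mem_head.
by apply: IHX Xw => b y z Xy; apply: PD; rewrite inE Xy orbT.
Qed.

(** The flag [U 0 = 0, U 1, ..., U k = V] witnesses that [T] acts nilpotently on
[V]: each operator of [T] maps [U i.+1] into [U i]; in particular any product of
[k] operators of [T] vanishes. The flag is indexed by all natural numbers and is
constant from [k] on; it is not required to be increasing. *)
Definition nil_flag (F : fieldType) (V : vectType F) (T : 'End(V) -> Prop)
    (k : nat) (U : nat -> {vspace V}) : Prop :=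
  [/\ U 0%N = 0%VS, forall i, (k <= i)%N -> U i = fullv
    & forall t i v, T t -> v \in U i -> t v \in U i.-1].

(** The commutator of two endomorphisms. *)
Definition lie (F : fieldType) (V : vectType F) (f g : 'End(V)) : 'End(V) :=
  ((f \o g) - (g \o f))%VF.

Lemma lieE (F : fieldType) (V : vectType F) (f g : 'End(V)) v :
  lie f g v = f (g v) - g (f v).
Proof. by rewrite /lie !lfun_simp. Qed.

Lemma lieC (F : fieldType) (V : vectType F) (f g : 'End(V)) :
  lie f g = - lie g f.
Proof. by rewrite /lie opprB. Qed.

Lemma liePl (F : fieldType) (V : vectType F) a (f1 f2 g : 'End(V)) :
  lie (a *: f1 + f2) g = a *: lie f1 g + lie f2 g.
Proof.
rewrite /lie comp_lfunDl comp_lfunDr -comp_lfunZl -comp_lfunZr scalerBr.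
by rewrite opprD addrACA.
Qed.

Lemma liePr (F : fieldType) (V : vectType F) a (f g1 g2 : 'End(V)) :
  lie f (a *: g1 + g2) = a *: lie f g1 + lie f g2.
Proof. by rewrite lieC liePl opprD -scalerN -!lieC. Qed.

Lemma lie0l (F : fieldType) (V : vectType F) (g : 'End(V)) : lie 0 g = 0.
Proof. by rewrite /lie comp_lfun0l comp_lfun0r subrr. Qed.

(** A flag for [T] is built one dimension at a time, provided that [T] has a
nonzero common null vector in the quotient by each proper stable subspace. *)
Lemma exists_flag (F : fieldType) (V : vectType F) (T : 'End(V) -> Prop) :
  (forall U : {vspace V}, U != fullv -> (forall t v, T t -> v \in U -> t v \in U) ->
     exists2 v, v \notin U & forall t, T t -> t v \in U) ->
  exists k U, nil_flag T k U.
Proof.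
move=> step.
suff: forall d k (U : nat -> {vspace V}), (\dim {:V} - \dim (U k) <= d)%N ->
    U 0%N = 0%VS -> (forall i, (k <= i)%N -> U i = U k) ->
    (forall t i v, T t -> v \in U i -> t v \in U i.-1) ->
    exists k U, nil_flag T k U.
  move/(_ _ 0%N (fun=> 0%VS) (leqnn _)); apply=> //.
  by move=> t i v _; rewrite !memv0 => /eqP->; rewrite linear0.
elim=> [|d IHd] k U dimU U0 Uk TU.
  exists k, U; split=> // i /Uk->; apply/eqP; rewrite eqEdim subvf.
  by rewrite -subn_eq0 -leqn0.
have [Ufull | nUfull] := eqVneq (U k) fullv.
  by exists k, U; split=> // i /Uk->.
have stabU t v : T t -> v \in U k -> t v \in U k.
  by rewrite -{1}(Uk k.+1) //; apply: TU.
have [v U'v Tv] := step _ nUfull stabU.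
(* The flag is extended by one more step, [U k + <[v]>]. *)
pose U' i := if (i <= k)%N then U i else (U k + <[v]>)%VS.
apply: (IHd k.+1 U'); rewrite /U' ?ltnn //.
- have ltU : (\dim (U k) < \dim (U k + <[v]>))%N.
    rewrite ltn_neqAle dimvS ?addvSl // andbT; apply: contra U'v => /eqP eqd.
    have /eqP -> : U k == (U k + <[v]>)%VS by rewrite eqEdim addvSl eqd /=.
    by apply: (subvP (addvSr _ _)); apply: memv_line.
  rewrite leq_subLR in dimU; rewrite leq_subLR.
  by apply: leq_trans dimU _; rewrite addnS -addSn leq_add2r.
- by move=> i lt_ki; rewrite leqNgt lt_ki.
move=> t i w Tt; case: leqP => [le_ik Uw | lt_ki].
  by rewrite (leq_trans (leq_pred i)) //; apply: TU.
have Uk1 : U i.-1 = U k by case: i lt_ki => // i; apply: Uk.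
case/memv_addP=> u Uu [_ /vlineP[a ->] ->].
have : t (u + a *: v) \in U k.
  by rewrite linearD linearZ /= memvD ?memvZ ?Tv ?stabU.
case: ifP => _; first by rewrite Uk1.
exact: (subvP (addvSl _ _)).
Qed.

(** If [T] acts nilpotently and the nilpotent operator [s] normalizes [T], then
[T] and [s] have a nonzero common null vector modulo [U]: the vectors killed by
[T] modulo [U] are stable under [s]. *)
Lemma flag_step (F : fieldType) (V : vectType F) (T : 'End(V) -> Prop) k U0
    (s : 'End(V)) (U : {vspace V}) :
  nil_flag T k U0 -> (exists m, forall v, iter m s v = 0) ->
  (forall t, T t -> T (lie t s)) -> U != fullv ->
  (forall t v, T t -> v \in U -> t v \in U) -> (forall v, v \in U -> s v \in U) ->
  exists v, [/\ v \notin U, s v \in U & forall t, T t -> t v \in U].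
Proof.
move=> [U00 Uk TU] [m sm0] Ts nU stabT stabs.
have [v U'v Tv] : exists2 v, v \notin U & forall t, T t -> t v \in U.
  have notsub : exists i, ~~ (U0 i <= U)%VS.
    exists k; rewrite Uk //; apply: contra nU => sU.
    by rewrite eqEsubv subvf.
  case: (ex_minnP notsub) => i /subvPn[v Uiv U'v] min_i.
  exists v => // t Tt; have Utv := TU t i v Tt Uiv.
  have [sU | /min_i le_i] := boolP (U0 i.-1 <= U)%VS.
    exact: (subvP sU).
  case: i le_i Uiv {min_i Utv} => [_ |i]; last by rewrite ltnn.
  by rewrite U00 memv0 => /eqP v0; rewrite v0 mem0v in U'v.
have Tsv j t : T t -> t (iter j s v) \in U.
  elim: j t => [|j IHj] t Tt /=; first exact: Tv.
  rewrite -(subrK (s (t (iter j s v))) (t _)) -lieE memvD ?IHj //.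
    exact: Ts.
  exact/stabs/IHj.
have hits : exists j, iter j s v \in U by exists m; rewrite sm0 mem0v.
case: (ex_minnP hits) => -[|j] Usv min_j; first by rewrite Usv in U'v.
exists (iter j s v); split=> //; last by move=> t; apply: Tsv.
by apply/negP => /min_j; rewrite ltnn.
Qed.

(** As in Engel's theorem, commutators with elements of [X] act nilpotently on all
endomorphisms, hence on the quotient by [<<X>>]. So [S], unless contained in
[<<X>>], has an element outside [<<X>>] that normalizes [<<X>>]. *)
Lemma flag_normalizer (F : fieldType) (V : vectType F) (S : 'End(V) -> Prop)
    (X : seq 'End(V)) k U :
  (forall f g, S f -> S g -> S (lie f g)) -> (forall f, f \in X -> S f) ->
  nil_flag (fun f => f \in <<X>>%VS) k U ->
  ~ (forall f, S f -> f \in <<X>>%VS) ->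
  exists s, [/\ S s, s \notin <<X>>%VS & forall t, t \in X -> lie t s \in <<X>>%VS].
Proof.
move=> Slie SX [U0 Uk XU] notsub; apply: NNPP => none.
have next f : S f -> f \notin <<X>>%VS ->
    exists t, [/\ t \in X, S (lie t f) & lie t f \notin <<X>>%VS].
  move=> Sf X'f; apply: NNPP => no_t; case: none; exists f; split=> // t Xt.
  apply/negPn/negP => X'tf; case: no_t; exists t; split=> //.
  by apply: Slie => //; apply: SX.
have [f [Sf X'f]] : exists f, S f /\ f \notin <<X>>%VS.
  apply: NNPP => no_f; case: notsub => f Sf.
  by apply/negPn/negP => X'f; case: no_f; exists f.
(* Otherwise commutators with [X] lead to some [g] in [S], outside [<<X>>], that
   lowers the flag by an arbitrary number of steps. For [m < k] the operator may
   still raise the flag, by [k - m] steps; for [m = 2 k] it vanishes. *)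
have shift m : exists g, [/\ S g, g \notin <<X>>%VS &
    forall i v, v \in U i -> g v \in U (i + k - m)%N].
  elim: m => [|m [g [Sg X'g gU]]].
    exists f; split=> // i v _; rewrite subn0 Uk ?memvf //; exact: leq_addl.
  have [t [Xt Stg X'tg]] := next g Sg X'g; exists (lie t g); split=> // i v Uiv.
  rewrite lieE memvB //.
    by rewrite subnS; apply: XU; [apply: memv_span | apply: gU].
  have := XU t i v (memv_span Xt) Uiv.
  case: i Uiv => [|i] Uiv /=; last by move/gU; rewrite addSn subSS.
  by rewrite U0 memv0 => /eqP->; rewrite linear0 mem0v.
have [g [_ X'g gU]] := shift (k + k)%N.
case/negP: X'g; suff -> : g = 0 by apply: mem0v.
apply/lfunP => v; rewrite lfunE /=; apply/eqP; rewrite -memv0 -U0.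
by rewrite -(subnn (k + k)%N); apply: gU; rewrite Uk ?memvf.
Qed.

(** Jacobson's theorem on weakly closed sets: a set of nilpotent operators that is
closed under commutators acts nilpotently. A span [<<X>>] of elements of [S] that
acts nilpotently and is closed under commutators is enlarged until it
contains [S]. *)
Lemma weakly_closed_flag (F : fieldType) (V : vectType F) (S : 'End(V) -> Prop) :
  (forall f g, S f -> S g -> S (lie f g)) ->
  (forall f, S f -> exists m, forall v, iter m f v = 0) ->
  exists k U, nil_flag S k U.
Proof.
move=> Slie Snil.
suff: forall d (X : seq 'End(V)), (\dim {:'End(V)} - \dim <<X>> <= d)%N ->
    (forall f, f \in X -> S f) ->
    (forall f g, f \in <<X>>%VS -> g \in <<X>>%VS -> lie f g \in <<X>>%VS) ->
    (exists k U, nil_flag (fun f => f \in <<X>>%VS) k U) ->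
    exists k U, nil_flag S k U.
  move/(_ _ [::] (leqnn _)); apply=> //.
    move=> f g; rewrite span_nil !memv0 => /eqP-> /eqP->.
    by rewrite lie0l.
  exists 1%N, (fun i => if i is 0%N then 0%VS else fullv).
  split=> // [[]// | t i v]; rewrite span_nil memv0 => /eqP-> _.
  by rewrite lfunE mem0v.
have done_if X : (forall f, S f -> f \in <<X>>%VS) ->
    (exists k U, nil_flag (fun f => f \in <<X>>%VS) k U) ->
    exists k U, nil_flag S k U.
  move=> SX [k [U [U0 Uk XU]]]; exists k, U; split=> // t i v /SX; exact: XU.
elim=> [|d IHd] X dimX XS Xlie Xflag.
  apply: (done_if X) => // f _.
  suff /eqP-> : <<X>>%VS == fullv by apply: memvf.
  by rewrite eqEdim subvf -subn_eq0 -leqn0.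
case: (classic (forall f, S f -> f \in <<X>>%VS)) => [/done_if | nSX]; first exact.
have [k [U XU]] := Xflag.
have [s [Ss X's Xs]] := flag_normalizer Slie XS XU nSX.
have {}Xs t : t \in <<X>>%VS -> lie t s \in <<X>>%VS.
  move: t; apply: span_ind; first by rewrite lie0l mem0v.
  by move=> a x y Xx Xy; rewrite liePl memvD ?memvZ ?(Xs x).
have memX' f : f \in <<s :: X>>%VS -> exists a t, t \in <<X>>%VS /\ f = a *: s + t.
  rewrite span_cons => /memv_addP[_ /vlineP[a ->] [t Xt ->]].
  by exists a, t.
have sXX' : (<<X>> <= <<s :: X>>)%VS by rewrite span_cons addvSr.
apply: (IHd (s :: X)).
- have ltX : (\dim <<X>> < \dim <<s :: X>>)%N.
    rewrite ltn_neqAle dimvS // andbT; apply: contra X's => /eqP eqd.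
    have /eqP -> : <<X>>%VS == <<s :: X>>%VS by rewrite eqEdim sXX' eqd /=.
    by apply: memv_span; apply: mem_head.
  rewrite leq_subLR in dimX; rewrite leq_subLR.
  by apply: leq_trans dimX _; rewrite addnS -addSn leq_add2r.
- by move=> f; rewrite inE => /orP[/eqP-> | /XS].
- move=> f g /memX'[a [t [Xt ->]]] /memX'[b [u [Xu ->]]].
  apply: (subvP sXX').
  rewrite liePl !liePr {1}/lie subrr scaler0 add0r (lieC s u).
  apply: memvD; first by rewrite memvZ ?memvN ?Xs.
  by apply: memvD; rewrite ?memvZ ?Xs ?Xlie.
apply: exists_flag => W nW stabW.
have stabX t v : t \in <<X>>%VS -> v \in W -> t v \in W.
  by move=> Xt; apply/stabW/(subvP sXX').
have stabs v : v \in W -> s v \in W by apply/stabW/memv_span/mem_head.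
have [v [W'v Wsv WXv]] := flag_step XU (Snil s Ss) Xs nW stabX stabs.
exists v => // _ /memX'[a [t [Xt ->]]].
by rewrite !lfun_simp memvD ?(WXv t) ?memvZ.
Qed.

(** * Left multiplications in a Leibniz algebra *)

Section Leibniz.

Variables (F : fieldType) (L : leibnizType F).
Implicit Types (x y z : L) (N U W : {vspace L}).

Lemma lmul_linear x : linear (lmul x).
Proof. by move=> a y z; rewrite linearPr. Qed.

HB.instance Definition _ x :=
  GRing.isLinear.Build F L L *:%R (lmul x) (lmul_linear x).

(** The left multiplication [L_x], as an endomorphism of the vector space [L]. *)
Definition leftmul x : 'End(L) := linfun (lmul x).

Lemma leftmulE x y : leftmul x y = lmul x y.
Proof. by rewrite lfunE. Qed.

Lemma iter_leftmul n x y : iter n (leftmul x) y = iter n (lmul x) y.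
Proof. by elim: n => //= n ->; rewrite leftmulE. Qed.

Lemma lmul0l x : lmul 0 x = 0 :> L.
Proof. exact: linear0l. Qed.

Lemma lmulDl x y z : lmul (x + y) z = lmul x z + lmul y z.
Proof. exact: linearDl. Qed.

Lemma lmulZl a x z : lmul (a *: x) z = a *: lmul x z.
Proof. exact: linearZl. Qed.

Lemma lmul_lmul x y z : lmul (lmul x y) z = lmul x (lmul y z) - lmul y (lmul x z).
Proof. by rewrite (lmul_derivation x y z) addrK. Qed.

(** The lower series decreases strictly until it stabilizes, so the nilpotency
index of [N] is bounded uniformly, by the dimension of [L]. *)
Lemma lprodv_iter_dim N :
  (lprodv N N <= N)%VS -> nilpotent_subalgebra N ->
  lower_series N (\dim {:L}) = 0%VS.
Proof.
move=> sNN [k]; rewrite /lower_series.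
have prod0 : lprodv N 0 = 0%VS.
  apply/eqP; rewrite -subv0; apply/lprodv_subP => u v _; rewrite memv0 => /eqP->.
  by rewrite linear0 mem0v.
have prodS U W : (U <= W)%VS -> (lprodv N U <= lprodv N W)%VS.
  move=> sUW; apply/lprodv_subP => u v Nu Uv.
  by apply: memv_lmul => //; apply: (subvP sUW).
suff: forall d W, (\dim W <= d)%N -> (lprodv N W <= W)%VS ->
    iter k (lprodv N) W = 0%VS -> iter d (lprodv N) W = 0%VS.
  by apply; rewrite ?dimvS ?subvf.
elim=> [|d IHd] W dimW sNW Wk.
  by apply/eqP; rewrite -dimv_eq0 -leqn0.
rewrite iterSr; apply: IHd; first 1 last.
- exact: prodS.
- by rewrite -iterSr iterS Wk.
have [W0 | nW] := eqVneq (lprodv N W) W.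
  have -> : W = 0%VS by rewrite -Wk; elim: (k) => //= i <-.
  by rewrite prod0 dimv0.
rewrite -ltnS; apply: leq_trans dimW; rewrite ltn_neqAle dimvS // andbT.
by apply: contra nW => eqd; rewrite eqEdim sNW (eqP eqd) /=.
Qed.

(** The first step, from [z] to [(xy)z], lands in the derived algebra of [S]; this
is the reason for the successor. *)
Lemma engel_of_strongly_solvable (S : {vspace L}) x y z :
  is_subalgebra S -> strongly_solvable S -> x \in S -> y \in S -> z \in S ->
  iter (\dim {:L}).+1 (lmul (lmul x y)) z = 0.
Proof.
move=> algS solS Sx Sy Sz; pose N := lprodv S S.
have sNN : (lprodv N N <= N)%VS.
  apply/lprodv_subP => u v Nu Nv.
  by apply: memv_lmul; apply: (subvP algS).
have Nh : lmul x y \in N by apply: memv_lmul.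
apply/eqP; rewrite -memv0 -(lprodv_iter_dim sNN solS) iterSr /lower_series.
elim: (\dim _) => [|n IHn]; last by rewrite !iterS; apply: memv_lmul.
by apply: memv_lmul => //; apply: (subvP algS).
Qed.

(** An Engel identity in two variables, holding for a fixed [x] and for all second
arguments, makes [L_(xy)] nilpotent on the whole algebra. *)
Lemma leftmul_nilpotent x y n :
  (forall n, exists2 s : seq F, uniq s & size s = n) ->
  (forall y', iter n (lmul (lmul x y')) x = 0 /\ iter n (lmul (lmul x y')) y' = 0) ->
  exists k, forall z, iter k (leftmul (lmul x y)) z = 0.
Proof.
move=> infF engel; set h := lmul x y; pose H := leftmul h.
have [j [W [HW Wj]]] := fitting_one H.
have WH z : z \in W -> lmul h z \in W.
  by rewrite -leftmulE -{2}HW; apply: memv_img.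
have injH z : z \in W -> lmul h z = 0 -> z = 0.
  by rewrite -leftmulE; apply: img_eq_inj.
have injHn m z : z \in W -> iter m (lmul h) z = 0 -> z = 0.
  elim: m z => //= m IHm z Wz; rewrite -iterS iterSr => /IHm eq0.
  by apply: injH => //; apply/eq0/WH.
have surH z : z \in W -> exists2 w, w \in W & lmul h w = z.
  by rewrite -{1}HW => /memv_imgP[w Ww ->]; exists w; rewrite // leftmulE.
(* Multiplying the Fitting-one component by an element of the Fitting-null
   component, on either side, gives elements of the Fitting-one component. *)
have WL0 m a : iter m (lmul h) a = 0 ->
    forall w, w \in W -> lmul a w \in W /\ lmul w a \in W.
  elim: m a => [|m IHm] a /=.
    by move=> -> w _; rewrite lmul0l linear0 !mem0v.
  rewrite -iterS iterSr => /IHm WLb w Ww.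
  split; move: w Ww.
    apply: (fitting_one_stable HW Wj) => w Ww.
    by rewrite !leftmulE (lmul_derivation h) addrK; case: (WLb w Ww).
  apply: (fitting_one_stable HW Wj (g := fun w => lmul w a)) => w Ww.
  by rewrite !leftmulE (lmul_derivation h) addrC addKr; case: (WLb w Ww).
have [Hx Hy] := engel y; rewrite -/h in Hx Hy.
have WX w : w \in W -> lmul x w \in W by case/(WL0 _ _ Hx).
have WY w : w \in W -> lmul y w \in W by case/(WL0 _ _ Hy).
have WYr w : w \in W -> lmul w y \in W by case/(WL0 _ _ Hy).
(* The coefficient of [a] in the Engel identity at [x], [y + a v]. *)
have first_order v w : v \in W -> w \in W -> lmul h w = lmul x v ->
    v + lmul w y = 0.
  move=> Wv Ww hw.
  have defB z : leftmul (lmul x v) z = H (leftmul w z) - leftmul w (H z).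
    by rewrite !leftmulE -hw lmul_lmul.
  have [c [c1 cE _]] := perturbed_iter y v n defB.
  have : c 1%N = 0.
    apply: (vector_poly_eq0 (m := n.+2) infF) => // a; rewrite -cE.
    have [_ Hy'] := engel (y + a *: v); rewrite -[RHS]Hy'.
    apply: eq_iter => z.
    by rewrite !leftmulE linearD linearZ /= lmulDl lmulZl.
  rewrite c1 !iter_leftmul Hy linear0 subr0 leftmulE => /injHn; apply.
  by rewrite memvD ?WYr.
(* [L_w] commutes with [H] because [L_(hw) = L_(xz) = [L_x, L_z] = 0]; hence [wy]
   is killed by a power of [H], and is zero. *)
have annW z : z \in W -> (forall t, lmul z t = 0) -> z = 0.
  move=> Wz z0; have [w Ww hw] := surH _ (WX z Wz).
  have comm t : lmul h (lmul w t) = lmul w (lmul h t).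
    apply/eqP; rewrite -subr_eq0 -lmul_lmul hw lmul_lmul.
    by rewrite !z0 linear0 subrr.
  have := first_order z w Wz Ww hw.
  suff -> : lmul w y = 0 by rewrite addr0.
  apply: (injHn n); first exact: WYr.
  suff -> : iter n (lmul h) (lmul w y) = lmul w (iter n (lmul h) y).
    by rewrite Hy linear0.
  by elim: (n) => //= m ->; rewrite comm.
(* [v - yw] annihilates [L] from the left, because [L_(wy) = - L_(yw)]. *)
have defY v w : v \in W -> w \in W -> lmul h w = lmul x v -> v = lmul y w.
  move=> Wv Ww hw; apply/eqP; rewrite -subr_eq0; apply/eqP.
  apply: annW => [|t]; first by rewrite memvB ?WY.
  have /eqP := first_order v w Wv Ww hw; rewrite addr_eq0 => /eqP ->.
  by rewrite -opprD linearNl /= lmulDl !lmul_lmul addrC subrKA subrr oppr0.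
have injX v : v \in W -> leftmul x v = 0 -> v = 0.
  by rewrite leftmulE => Wv xv0; rewrite (defY v 0) ?mem0v ?linear0.
have sXW : (leftmul x @: W <= W)%VS.
  by apply/subvP => _ /memv_imgP[w Ww ->]; rewrite leftmulE WX.
have imX := inj_img_eq sXW injX.
have surX v : v \in W -> lmul x (lmul y v) = lmul h v.
  move=> Wv; have := WH v Wv; rewrite -{1}imX => /memv_imgP[u Wu].
  by rewrite leftmulE => xu; rewrite -(defY u v).
have injY v : v \in W -> lmul y v = 0 -> v = 0.
  by move=> Wv yv0; apply: injH => //; rewrite -surX // yv0 linear0.
exists j => z; move: (Wj z) => /=; set v := iter _ _ _ => Wv.
apply: injX => //; rewrite leftmulE; apply: injY; first exact: WX.
have := lmul_lmul x y v; rewrite -/h surX // => /eqP.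
by rewrite -subr_eq0 opprB addrC subrK => /eqP.
Qed.

(** Strong solvability from the nilpotency of the left multiplications by
products, which form a set closed under commutators. *)
Lemma lprodv_nilpotent :
  (forall x y, exists k, forall z, iter k (leftmul (lmul x y)) z = 0) ->
  @strongly_solvable F L fullv.
Proof.
move=> nilP.
pose S f := exists x y, f = leftmul (lmul x y).
have [||k [U [U0 Uk SU]]] := @weakly_closed_flag F L S.
- move=> _ _ [x [y ->]] [z [t ->]]; exists (lmul x y), (lmul z t).
  by apply/lfunP => v; rewrite lieE !leftmulE (lmul_lmul (lmul x y)).
- by move=> _ [x [y ->]]; apply: nilP.
pose N : {vspace L} := lprodv fullv fullv.
have NU i v n : n \in N -> v \in U i -> lmul n v \in U i.-1.
  move=> Nn Uv; move: n Nn; apply: span_ind; first by rewrite lmul0l mem0v.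
  move=> a _ y /allpairsP[[b c] /= [_ _ ->]] Uy.
  rewrite lmulDl lmulZl memvD ?memvZ // -leftmulE; apply: SU Uv.
  by exists b, c.
exists k; apply/eqP; rewrite -subv0 -U0 -(subnn k) /lower_series.
elim: {1 3}k => [|j IHj] /=; first by rewrite subn0 Uk ?subvf.
apply/lprodv_subP => n v Nn jv; rewrite subnS; apply: NU => //.
exact: (subvP IHj).
Qed.

End Leibniz.

Local Close Scope ring_scope.

Theorem theorem3 (F : fieldType)
  (hF : [pchar F]%R =i pred0 \/
        (GRing.closed_field_axiom F /\ exists p : nat, p \in [pchar F]%R /\ 5 < p)) :
  recognizeable 2 (@strongly_solvable F).
Proof.
have infF : forall n, exists2 s : seq F, uniq s & size s = n.
  by apply: infinite_field; case: hF => [|[]]; [left | right].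
move=> L solv; apply: lprodv_nilpotent => x y.
apply: (leftmul_nilpotent y (n := (\dim {:L}).+1) infF) => y'.
have mem_gen := @sub_subalg_gen F L [tuple x; y'].
have Sx : x \in subalg_gen [tuple x; y'] by apply: mem_gen; rewrite !inE eqxx.
have Sy : y' \in subalg_gen [tuple x; y'] by apply: mem_gen; rewrite !inE eqxx orbT.
by split; apply: (engel_of_strongly_solvable (subalg_genP _) (solv [tuple x; y'])).
Qed.
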